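(* Let $F$ be a field of characteristic $0$ and $C$ an associative composition algebra over $F$. Let $X\in H_3(C)$. - If there exist $\gamma\in F^\times$ and $v\in V_3(C)$ such that $(X,v)$ is rank one in $U(\gamma)$, then $n(X)=0$, so $X$ has rank at most $2$. - If $X$ has rank exactly two, then for $\gamma\in F^\times$ and $v\in V_3(C)$, $(X,v)$ is rank one in $U(\gamma)$ if and only if $X^\#=-\gamma v^*v$. - If $X$ has rank exactly two, the set of pairs $(\gamma,v)$ with $\gamma\in F^\times$, $v\in V_3(C)$ and $X^\#=-\gamma v^*v$ is non-empty, and the class of $\gamma$ in $F^\times/n_C(C^\times)$ is uniquely determined by $X$.
   Context: **Composition algebras.** $C$ is one of: $F$; a quadratic étale $F$-algebra; a quaternion $F$-algebra. It carries the standard involution $*$, with $n_C(x)=xx^*$ and $\tr_C(x)=x+x^*$. **Hermitian matrices.** $H_3(C)$ is the set of Hermitian $3\times3$ matrices over $C$ ($^*$ = conjugate transpose). For $X$ with diagonal $c_1,c_2,c_3$ and $X_{12}=a_3$, $X_{13}=a_2^*$, $X_{23}=a_1$: $$n(X)=c_1c_2c_3-\sum c_in_C(a_i)+\tr_C(a_1a_2a_3).$$ The adjoint $X^\#$ is the quadratic polynomial map with $X^\#=n(X)X^{-1}$ for invertible $X$. The pairing is $(X,Y)=\sum c_ic_i'+\sum\tr_C(a_j^*a_j')$. Ranks in $H_3(C)$: - $X$ has rank at most two if $n(X)=0$; - $X$ has rank exactly two if $n(X)=0$ and $X^\#\neq0$. **The cubic norm structure $U(\gamma)$.** $V_3(C)=C^3$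 denotes row vectors. For $\gamma\in F^\times$, $U(\gamma)=H_3(C)\oplus V_3(C)$ is the cubic norm structure with: - $n((X,v))=n(X)+\gamma vXv^*$; - $(X,v)^\#=(X^\#+\gamma v^*v,\;-vX)$; - pairing $((X,v),(Y,w))=(X,Y)-\gamma(vw^*+wv^* )$. (It is isomorphic to $H_3$ of the Cayley–Dickson double of $C$.) An element $u$ of $U(\gamma)$ is rank one if $u\neq0$ and $u^\#=0$. *)

(* Defs.v *)
From HB Require Import structures.
From mathcomp Require Import all_boot all_order all_algebra all_field.
From mathcomp Require Import ring.
Set Implicit Arguments.
Unset Strict Implicit.
Unset Printing Implicit Defensive.
Import GRing.Theory.
Local Open Scope ring_scope.

Section CompositionAlgebras.

Context {F : fieldType} {C : falgType F}.
Implicit Types (star : C -> C) (x y : C).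

(* C is isomorphic to F[T]/(f) with f monic, separable, of degree 2. *)
Definition quadratic_etale_algebra : Prop :=
  exists x (f : {poly F}),
    [/\ f \is monic, size f = 3%N, separable_poly f, horner_alg x f = 0
      & basis_of {:C} [:: 1; x]].

(* C is isomorphic to (a, b)_F; this presentation is the usual one away from
   characteristic 2. *)
Definition quaternion_algebra : Prop :=
  exists (a b : F) (i j : C),
    [/\ a != 0 /\ b != 0, i * i = a%:A, j * j = b%:A, i * j = - (j * i)
      & basis_of {:C} [:: 1; i; j; i * j]].

(* On each of the algebras below there is exactly one such map: the identity
   of F, the nontrivial F-automorphism of a quadratic etale algebra, quaternion
   conjugation. *)
Definition standard_involution star : Prop :=
  [/\ linear star, involutive star, forall x y, star (x * y) = star y * star x
    & forall x, x * star x \in (1%VS : {vspace C})].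

Definition assoc_composition_algebra star : Prop :=
  [\/ \dim {:C} = 1%N, quadratic_etale_algebra | quaternion_algebra]
  /\ standard_involution star.

(* The inverse of k |-> k%:A on the line F.1 (see in_algK, algK). *)
Definition scalar_part : C -> F := coord [tuple (1 : C)] ord0.

Definition comp_norm star x : F := scalar_part (x * star x).
Definition comp_trace star x : F := scalar_part (x + star x).

End CompositionAlgebras.

Section HermitianMatrices.

Context {F : fieldType} {C : falgType F} (star : C -> C).
Implicit Types (X Y : 'M[C]_3).

Definition conjtr m n (A : 'M[C]_(m, n)) : 'M[C]_(n, m) := (map_mx star A)^T.

Definition is_hermitian X : Prop := conjtr X = X.

Definition herm3 (c1 c2 c3 : F) (a1 a2 a3 : C) : 'M[C]_3 :=
  \matrix_(i, j) nth 0 (nth [::] [:: [:: c1%:A;   a3;      star a2];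
                                     [:: star a3; c2%:A;   a1     ];
                                     [:: a2;      star a1; c3%:A  ]] i) j.

(* The coordinates c_i and a_i of a Hermitian X (see hermitianE); a_2 is read
   off below the diagonal. *)
Definition c_ X (i : 'I_3) : F := scalar_part (X i i).
Definition a1_ X : C := X 1 2.
Definition a2_ X : C := X 2 0.
Definition a3_ X : C := X 0 1.

Definition herm_norm X : F :=
  let c1 := c_ X 0 in let c2 := c_ X 1 in let c3 := c_ X 2 in
  let a1 := a1_ X in let a2 := a2_ X in let a3 := a3_ X in
  c1 * c2 * c3
  - (c1 * comp_norm star a1 + c2 * comp_norm star a2 + c3 * comp_norm star a3)
  + comp_trace star (a1 * a2 * a3).

(* The only quadratic map equal to n(X) X^-1 on invertible Hermitian X: see
   is_adjoint, herm_adjP and is_adjoint_unique. *)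
Definition herm_adj X : 'M[C]_3 :=
  let c1 := c_ X 0 in let c2 := c_ X 1 in let c3 := c_ X 2 in
  let a1 := a1_ X in let a2 := a2_ X in let a3 := a3_ X in
  herm3 (c2 * c3 - comp_norm star a1)
        (c3 * c1 - comp_norm star a2)
        (c1 * c2 - comp_norm star a3)
        (star a3 * star a2 - c1 *: a1 : C)
        (star a1 * star a3 - c2 *: a2 : C)
        (star a2 * star a1 - c3 *: a3 : C).

Definition rank_at_most_two X : Prop := herm_norm X = 0.
Definition rank_exactly_two X : Prop := herm_norm X = 0 /\ herm_adj X <> 0.

(* Elements of U(gamma) are the pairs (X, v) with X Hermitian. *)
Definition U_adj (gamma : F) (u : 'M[C]_3 * 'rV[C]_3) : 'M[C]_3 * 'rV[C]_3 :=
  (herm_adj u.1 + gamma%:A *: (conjtr u.2 *m u.2), - (u.2 *m u.1)).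

Definition U_rank_one (gamma : F) (u : 'M[C]_3 * 'rV[C]_3) : Prop :=
  [/\ is_hermitian u.1, u <> 0 & U_adj gamma u = 0].

(* 'M[C]_3 is an lmodType over C only, so F-scalings are written k%:A *: X. *)
Definition quadratic_map (f : 'M[C]_3 -> 'M[C]_3) : Prop :=
  exists B : 'M[C]_3 -> 'M[C]_3 -> 'M[C]_3,
    [/\ forall (k : F) X X' Y, B (k%:A *: X + X') Y = k%:A *: B X Y + B X' Y,
        forall (k : F) X Y Y', B X (k%:A *: Y + Y') = k%:A *: B X Y + B X Y'
      & forall X, is_hermitian X -> f X = B X X].

Definition is_adjoint (f : 'M[C]_3 -> 'M[C]_3) : Prop :=
  quadratic_map f /\
  forall X Y, is_hermitian X -> X *m Y = 1%:M -> Y *m X = 1%:M ->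
    f X = (herm_norm X)%:A *: Y.

End HermitianMatrices.

(* Decides equations between sums in an abelian group. *)
Local Ltac zmod_bubble t := first [ rewrite [_ + (t + _)]addrCA | rewrite [_ + t]addrC ].
Local Ltac zmod_loop :=
  lazymatch goal with
  | |- 0 = 0 => reflexivity
  | |- - ?t + ?t = 0 => exact: addNr
  | |- ?t + - ?t = 0 => exact: subrr
  | |- - ?t + (?t + _) = 0 => rewrite addKr; zmod_loop
  | |- ?t + (- ?t + _) = 0 => rewrite addNKr; zmod_loop
  | |- - ?t + _ = 0 => zmod_bubble t; zmod_loop
  | |- ?t + _ = 0 => zmod_bubble (- t); zmod_loop
  end.
Local Ltac zmod :=
  apply/eqP; rewrite -subr_eq0; apply/eqP;
  rewrite ?(opprD, opprK, oppr0, addr0, add0r, opprB) -?addrA; zmod_loop.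

Section CompositionTheory.

Context {F : fieldType} {C : falgType F} {star : C -> C}.
Hypothesis starP : standard_involution star.
Implicit Types (x y z : C) (k : F).

Lemma in_algK k : scalar_part (k%:A : C) = k.
Proof.
rewrite /scalar_part linearZ /= -[X in coord _ _ X]/([tuple (1 : C)]`_(@ord0 0)).
by rewrite coord_free ?eqxx ?mulr1 // seq1_free oner_eq0.
Qed.

Lemma algK x : x \in (1%VS : {vspace C}) -> (scalar_part x)%:A = x.
Proof. by case/vlineP=> k ->; rewrite in_algK. Qed.

Lemma starZD k x y : star (k *: x + y) = k *: star x + star y.
Proof. by case: starP => h _ _ _; apply: h. Qed.

Lemma starD x y : star (x + y) = star x + star y.
Proof. by rewrite -[x]scale1r starZD !scale1r. Qed.

Lemma star0 : star 0 = 0.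
Proof. by apply: (addrI (star 0)); rewrite -starD !addr0. Qed.

Lemma starZ k x : star (k *: x) = k *: star x.
Proof. by rewrite -[k *: x]addr0 starZD star0 addr0. Qed.

Lemma starN x : star (- x) = - star x.
Proof. by rewrite -scaleN1r starZ scaleN1r. Qed.

Lemma starB x y : star (x - y) = star x - star y.
Proof. by rewrite starD starN. Qed.

Lemma starK x : star (star x) = x.
Proof. by case: starP => _ h _ _; apply: h. Qed.

Lemma starM x y : star (x * y) = star y * star x.
Proof. by case: starP => _ _ h _; apply: h. Qed.

Lemma star1 : star 1 = 1.
Proof. by rewrite -[RHS]starK -[star 1 in RHS]mulr1 starM starK mulr1. Qed.

Lemma starA k : star k%:A = k%:A.
Proof. by rewrite starZ star1. Qed.

Lemma comp_normE x : (comp_norm star x)%:A = x * star x.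
Proof. by apply: algK; case: starP. Qed.

Lemma comp_traceE x : (comp_trace star x)%:A = x + star x.
Proof.
apply: algK; have h y : y * star y \in (1%VS : {vspace C}) by case: starP.
have -> : x + star x = (1 + x) * star (1 + x) - 1 * star 1 - x * star x.
  rewrite starD star1 mulr1 mulrDr mulr1 mulrDl mul1r.
  by zmod.
by rewrite !rpredB.
Qed.

Lemma comp_normEC x : (comp_norm star x)%:A = star x * x.
Proof.
have -> : star x * x = x * star x.
  have e : star x = (comp_trace star x)%:A - x.
    by rewrite comp_traceE addrC addKr.
  by rewrite e mulrBl mulrBr -scalerAl mul1r -scalerAr mulr1.
exact: comp_normE.
Qed.

End CompositionTheory.

Section HermitianTheory.

Context {F : fieldType} {C : falgType F} {star : C -> C}.
Hypothesis charF : [pchar F] =i pred0.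
Hypothesis starP : standard_involution star.
Implicit Types (X Y : 'M[C]_3) (x y z : C) (k : F).

Local Notation nC := (comp_norm star).
Local Notation tC := (comp_trace star).

Let mul_star x : x * star x = (nC x)%:A.
Proof. by rewrite comp_normE. Qed.
Let star_mul x : star x * x = (nC x)%:A.
Proof. by rewrite comp_normEC. Qed.
Let mulA_star x y : x * (star x * y) = nC x *: y.
Proof. by rewrite mulrA mul_star -scalerAl mul1r. Qed.
Let starA_mul x y : star x * (x * y) = nC x *: y.
Proof. by rewrite mulrA star_mul -scalerAl mul1r. Qed.

Lemma comp_traceC x y : tC (x * y) = tC (y * x).
Proof.
rewrite -[LHS](in_algK (C := C)) -[RHS](in_algK (C := C)); congr scalar_part.
have e z : star z = (tC z)%:A - z by rewrite comp_traceE // addrC addKr.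
rewrite !(comp_traceE starP) !(starM starP) !e.
rewrite !(mulrDl, mulrDr, mulrN, mulNr) -!scalerAl -!scalerAr !mul1r !mulr1.
by rewrite !scalerA [tC y * tC x]mulrC; zmod.
Qed.

Lemma fixed_scalar x : star x = x -> (scalar_part x)%:A = x.
Proof.
move=> fx; apply: algK.
have : 2%:R *: x = (tC x)%:A by rewrite (comp_traceE starP) fx scaler_nat mulr2n.
move=> /(congr1 (fun y => 2%:R^-1 *: y)); rewrite !scalerA mulVf ?scale1r.
  by move=> ->; rewrite rpredZ // memv_line.
by have := charF 2%N; rewrite !inE /= => ->.
Qed.

Lemma hermitianE X : is_hermitian star X ->
  X = herm3 star (c_ X 0) (c_ X 1) (c_ X 2) (a1_ X) (a2_ X) (a3_ X).
Proof.
move=> /matrixP hX; have {}hX i j : star (X j i) = X i j by have := hX i j; rewrite !mxE.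
by apply/matrixP=> -[[|[|[|//]]] i] [[|[|[|//]]] j]; rewrite mxE /=
   ?fixed_scalar ?hX //; congr (X _ _); apply: val_inj.
Qed.

Lemma herm3_hermitian c1 c2 c3 a1 a2 a3 :
  is_hermitian star (herm3 star c1 c2 c3 a1 a2 a3).
Proof.
by apply/matrixP=> -[[|[|[|//]]] i] [[|[|[|//]]] j]; rewrite !mxE /=
   ?(starA starP) ?(starK starP).
Qed.

Lemma herm3_c c1 c2 c3 a1 a2 a3 (X := herm3 star c1 c2 c3 a1 a2 a3) :
  [/\ c_ X 0 = c1, c_ X 1 = c2, c_ X 2 = c3 & [/\ a1_ X = a1, a2_ X = a2 & a3_ X = a3]].
Proof. by rewrite /c_ /a1_ /a2_ /a3_ /X !mxE /= !in_algK. Qed.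

Lemma conjtrM m n p (A : 'M[C]_(m, n)) (B : 'M[C]_(n, p)) :
  conjtr star (A *m B) = conjtr star B *m conjtr star A.
Proof.
apply/matrixP=> i j; rewrite !mxE (big_morph star (starD starP) (star0 starP)).
by apply: eq_bigr => k _; rewrite !mxE (starM starP).
Qed.

Lemma conj_scalar_mx k : conjtr star (k%:A%:M : 'M[C]_3) = k%:A%:M.
Proof.
apply/matrixP=> i j; rewrite !mxE eq_sym.
by case: (i == j); rewrite ?mulr1n ?mulr0n ?(starA starP) ?(star0 starP).
Qed.

Lemma herm_adj_hermitian X : is_hermitian star (herm_adj star X).
Proof. exact: herm3_hermitian. Qed.

Lemma mul_herm_adj X : is_hermitian star X ->
  X *m herm_adj star X = (herm_norm star X)%:A%:M.
Proof.
move=> hX; rewrite {1}(hermitianE hX) /herm_adj /herm_norm.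
move: (c_ X 0) (c_ X 1) (c_ X 2) (a1_ X) (a2_ X) (a3_ X) => c1 c2 c3 a1 a2 a3.
have t2 : tC (a1 * a2 * a3) = tC (a3 * a1 * a2) by rewrite comp_traceC mulrA.
have t3 : tC (a1 * a2 * a3) = tC (a2 * a3 * a1) by rewrite -mulrA comp_traceC.
have tE x y z : tC (x * y * z) *: (1 : C) = x * (y * z) + star z * (star y * star x).
  by rewrite (comp_traceE starP) !(starM starP) -mulrA.
apply/matrixP=> -[[|[|[|//]]] i] [[|[|[|//]]] j];
  rewrite !mxE !big_ord_recl big_ord0 !mxE /= /bump /=.
all: rewrite ?mulr1n ?mulr0n ?addr0.
all: rewrite ?(starB starP) ?(starM starP) ?(starZ starP) ?(starK starP).
all: rewrite ?(mulrBl, mulrBr, mulrDl, mulrDr) -?scalerAl -?scalerAr ?mul1r ?mulr1.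
all: rewrite -?mulrA ?(mul_star, star_mul, mulA_star, starA_mul).
all: rewrite ?scalerBl ?scalerDl ?scalerBr ?scalerDl ?scalerA.
all: rewrite -?mulrA ?[c2 * c1]mulrC ?[c3 * c1]mulrC ?[c3 * c2]mulrC
  ?[c2 * (c1 * _)]mulrCA ?[c2 * (c3 * c1)]mulrCA ?[c3 * (c1 * c2)]mulrCA
  ?[c3 * c2]mulrC ?[c2 * c1]mulrC.
- rewrite [a1 * (a2 * a3)]mulrA t2 tE scaleNr !scalerDl; zmod.
- by zmod.
- by zmod.
- by zmod.
- by rewrite [a1 * (a2 * a3)]mulrA tE scaleNr !scalerDl -?mulrA; zmod.
- by zmod.
- by zmod.
- by zmod.
- by rewrite [a1 * (a2 * a3)]mulrA t3 tE scaleNr !scalerDl; zmod.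
Qed.

Lemma herm_adj_mul X : is_hermitian star X ->
  herm_adj star X *m X = (herm_norm star X)%:A%:M.
Proof.
move=> hX; rewrite -conj_scalar_mx -mul_herm_adj // conjtrM.
by rewrite hX herm_adj_hermitian.
Qed.

Let mulmxZ k (A B : 'M[C]_3) : A *m (k%:A *: B) = k%:A *: (A *m B).
Proof.
apply/matrixP=> i j; rewrite !mxE mulr_sumr; apply: eq_bigr => l _.
by rewrite !mxE -!scalerAl !mul1r -scalerAr.
Qed.

Lemma herm_adj_quadratic : quadratic_map star (herm_adj star).
Proof.
pose B (X Y : 'M[C]_3) : 'M[C]_3 :=
  herm3 star (c_ X 1 * c_ Y 2 - scalar_part (a1_ X * star (a1_ Y)))
             (c_ X 2 * c_ Y 0 - scalar_part (a2_ X * star (a2_ Y)))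
             (c_ X 0 * c_ Y 1 - scalar_part (a3_ X * star (a3_ Y)))
             (star (a3_ X) * star (a2_ Y) - c_ X 0 *: a1_ Y : C)
             (star (a1_ X) * star (a3_ Y) - c_ X 1 *: a2_ Y : C)
             (star (a2_ X) * star (a1_ Y) - c_ X 2 *: a3_ Y : C).
have spD (x y : C) : scalar_part (x + y) = scalar_part x + scalar_part y.
  exact: linearD.
have spZ k (x : C) : scalar_part (k *: x) = k * scalar_part x by exact: linearZ.
have cE k (X Y : 'M[C]_3) i : c_ (k%:A *: X + Y) i = k * c_ X i + c_ Y i.
  by rewrite /c_ !mxE -scalerAl mul1r spD spZ.
have aE k (X Y : 'M[C]_3) : [/\ a1_ (k%:A *: X + Y) = k *: a1_ X + a1_ Y,
    a2_ (k%:A *: X + Y) = k *: a2_ X + a2_ Y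
    & a3_ (k%:A *: X + Y) = k *: a3_ X + a3_ Y].
  by rewrite /a1_ /a2_ /a3_ !mxE -!scalerAl !mul1r.
have herm3D k c1 c2 c3 a1 a2 a3 c1' c2' c3' a1' a2' a3' :
  k%:A *: herm3 star c1 c2 c3 a1 a2 a3 + herm3 star c1' c2' c3' a1' a2' a3' =
  herm3 star (k * c1 + c1') (k * c2 + c2') (k * c3 + c3')
    (k *: a1 + a1' : C) (k *: a2 + a2' : C) (k *: a3 + a3' : C).
  apply/matrixP=> -[[|[|[|//]]] i] [[|[|[|//]]] j]; rewrite !mxE /=
    -?scalerAl ?mul1r ?(starZD starP) //; by rewrite scalerDl scalerA.
have hc (k b c d e f : F) : (k * b + c) * d - (k * e + f) =
  k * (b * d - e) + (c * d - f).
  by rewrite mulrDl mulrBr mulrA; zmod.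
have hd (k b c d e f : F) : d * (k * b + c) - (k * e + f) =
  k * (d * b - e) + (d * c - f).
  by rewrite mulrDr mulrBr mulrCA; zmod.
have spl k (x y z : C) : scalar_part ((k *: x + y) * z) =
    k * scalar_part (x * z) + scalar_part (y * z).
  by rewrite mulrDl -scalerAl spD spZ.
have spr k (x y z : C) : scalar_part (z * (k *: x + y)) =
    k * scalar_part (z * x) + scalar_part (z * y).
  by rewrite mulrDr -scalerAr spD spZ.
exists B; split=> //.
- move=> k X X' Y; case: (aE k X X') => e1 e2 e3.
  rewrite /B !cE e1 e2 e3 herm3D; congr herm3.
  1-3: by rewrite spl hc.
  1-3: by rewrite (starZD starP) mulrDl -scalerAl scalerDl scalerBr scalerA; zmod.
- move=> k X Y Y'; case: (aE k Y Y') => e1 e2 e3.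
  rewrite /B !cE e1 e2 e3 herm3D; congr herm3.
  1-3: by rewrite (starZD starP) spr hd.
  1-3: rewrite (starZD starP) mulrDr -scalerAr scalerDr scalerBr !scalerA.
  1-3: by rewrite [k * _]mulrC; zmod.
Qed.

Lemma herm_adjP : is_adjoint star (herm_adj star).
Proof.
split=> [|X Y hX XY _]; first exact: herm_adj_quadratic.
by rewrite -[LHS]mulmx1 -XY mulmxA herm_adj_mul // mul_scalar_mx.
Qed.

Let nonroot (P : {poly F}) : P != 0 -> exists t, P.[t] != 0.
Proof.
move=> P0; pose rs := [seq i%:R : F | i <- iota 0 (size P)].
have urs : uniq rs.
  rewrite map_inj_in_uniq ?iota_uniq // => m n _ _.
  wlog le_mn : m n / (m <= n)%N.
    by move=> W e; case/orP: (leq_total m n) => l; [exact: W | exact/esym/W].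
  move=> /esym/eqP; rewrite -subr_eq0 -natrB // (pcharf0P F).1 // subn_eq0.
  by move=> le_nm; apply/eqP; rewrite eqn_leq le_mn.
case: (boolP (all (root P) rs)) => [ar|/allPn[t _ nt]]; last by exists t.
by have := max_poly_roots P0 ar urs; rewrite size_map size_iota ltnn.
Qed.

Let inv_adj f X : is_adjoint star f -> is_hermitian star X ->
  herm_norm star X != 0 -> f X = herm_adj star X.
Proof.
move=> [_ hf] hX n0; pose Y := (herm_norm star X)^-1%:A *: herm_adj star X.
have nV : (herm_norm star X)%:A * (herm_norm star X)^-1%:A = 1 :> C.
  by rewrite -scalerAl mul1r scalerA divff // scale1r.
have nV' : (herm_norm star X)^-1%:A * (herm_norm star X)%:A = 1 :> C.
  by rewrite -scalerAl mul1r scalerA mulVf // scale1r.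
have YX : Y *m X = 1%:M by rewrite -scalemxAl herm_adj_mul // scale_scalar_mx nV'.
have XY : X *m Y = 1%:M by rewrite mulmxZ mul_herm_adj // scale_scalar_mx nV'.
by rewrite (hf X Y) // /Y scalerA nV scale1r.
Qed.

Lemma is_adjoint_unique f X : is_adjoint star f -> is_hermitian star X ->
  f X = herm_adj star X.
Proof.
move=> adjf hX; have h1 : is_hermitian star 1%:M.
  by have := conj_scalar_mx 1; rewrite scale1r.
pose Z t : 'M[C]_3 := t%:A *: 1%:M + X.
have hZ t : is_hermitian star (Z t).
  rewrite /is_hermitian /Z scale_scalar_mx mulr1; apply/matrixP=> i j.
  have /matrixP/(_ i j) := hX; have /matrixP/(_ i j) := conj_scalar_mx t.
  by rewrite !mxE (starD starP) => -> ->.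
have expE g : is_adjoint star g -> exists E, forall t,
    g (Z t) = t%:A *: (t%:A *: g 1%:M + E) + g X.
  move=> [[B [Bl Br gE]] _]; exists (B 1%:M X + B X 1%:M) => t.
  by rewrite !gE // /Z Bl !Br !scalerDr !addrA.
have [E fE] := expE _ adjf; have [E' gE] := expE _ herm_adjP.
have n1 : herm_norm star 1%:M != 0.
  have s1 : scalar_part (1 : C) = 1 by rewrite -[in LHS](scale1r 1) in_algK.
  have s0 : scalar_part (0 : C) = 0 by rewrite /scalar_part linear0.
  rewrite /herm_norm /c_ /a1_ /a2_ /a3_ /comp_norm /comp_trace !mxE /=.
  rewrite !mulr1n !mulr0n !mul0r (star0 starP) !addr0 s1 s0 !mulr0.
  by rewrite !addr0 subr0 !mulr1 oner_eq0.
have f1 := inv_adj adjf h1 n1.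
have key t : herm_norm star (Z t) != 0 ->
    t%:A *: (E - E') = herm_adj star X - f X.
  move=> nt; have := inv_adj adjf (hZ t) nt; rewrite fE gE f1 !scalerDr.
  rewrite -!addrA => /addrI e; rewrite scalerN; apply/eqP.
  by rewrite subr_eq addrAC -subr_eq opprK e addrC.
have [P [P0 PE]] : exists P : {poly F}, P != 0 /\
    forall t, herm_norm star (Z t) = P.[t].
  pose c i := c_ X i.
  pose n1_ := nC (a1_ X); pose n2_ := nC (a2_ X); pose n3_ := nC (a3_ X).
  pose al := n1_ + n2_ + n3_.
  pose be := c 0 * n1_ + c 1 * n2_ + c 2 * n3_ - tC (a1_ X * a2_ X * a3_ X).
  pose Q := \prod_(a <- [:: - c 0; - c 1; - c 2]) ('X - a%:P).
  exists (Q - (al%:P * 'X + be%:P)); split=> [|t].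
    have sQ : size Q = 4%N by rewrite size_prod_XsubC.
    rewrite -size_poly_eq0 size_polyDl sQ // size_polyN size_MXaddC.
    by case: ifP => // _; rewrite ltnS size_polyC; case: (_ != 0).
  have cZ i : c_ (Z t) i = t + c i.
    rewrite /c_ /Z !mxE eqxx mulr1n mulr1 -[RHS]/(t + scalar_part (X i i)).
    by rewrite -[t in RHS](in_algK (C := C)); exact: linearD.
  have aZ : [/\ a1_ (Z t) = a1_ X, a2_ (Z t) = a2_ X & a3_ (Z t) = a3_ X].
    by rewrite /a1_ /a2_ /a3_ /Z !mxE /= !mulr0n !mulr0 !add0r.
  case: aZ => e1 e2 e3; rewrite /herm_norm !cZ e1 e2 e3.
  rewrite /Q unlock /= !hornerE /= !opprK /be /al -/n1_ -/n2_ -/n3_.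
  ring.
have [t] := nonroot P0.
have [t'] : exists t', (P * ('X - t%:P)).[t'] != 0.
  by apply: nonroot; rewrite mulf_neq0 // polyXsubC_eq0.
rewrite hornerM hornerXsubC mulf_eq0 negb_or -!PE => /andP[nt' tt'] nt.
have := key _ nt'; rewrite -{1}(key _ nt) => /eqP.
rewrite -subr_eq0 -scalerBl -scalerBl => /eqP.
move=> /(congr1 (fun M => (t' - t)^-1%:A *: M)); rewrite scaler0 scalerA.
rewrite -scalerAl mul1r scalerA mulVf // !scale1r => e.
by have := key _ nt; rewrite e scaler0 => /esym/eqP; rewrite subr_eq0 => /eqP.
Qed.
End HermitianTheory.

(* Main.v *)
Require Import Defs.
From HB Require Import structures.
From mathcomp Require Import all_boot all_order all_algebra all_field.
From mathcomp Require Import ring.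
Set Implicit Arguments.
Unset Strict Implicit.
Unset Printing Implicit Defensive.
Import GRing.Theory.
Local Open Scope ring_scope.

(** On each of the algebras C the trace form tr(xy) is nondegenerate.  Hence, if
    v^* v <> 0, some right-linear combination v u of the entries of v has nonzero
    norm: either some n(v_i) is nonzero, or all vanish and
    n(v_i + v_j c) = tr(v_i^* v_j c), where v_i^* v_j <> 0.  Multiplying by such a
    u shows that v^* w = 0 forces w = 0 (so X^# X = n(X) = 0 gives v X = 0), and
    turns an equation g v^* v = g' v'^* v' into g n(v u) = g' n(v' u).

    For the existence of v, Y = X^# satisfies Y^# = n(X) X = 0, that is
    Y_ik Y_kj = Y_kk Y_ij.  If some Y_kk is nonzero, then v is the k-th row of Y.
    Otherwise v is the row p^* of the column p = Y (e_k + e_l c), with c such that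
    tr(Y_kl c) <> 0. *)

(** * Nondegeneracy of the trace form on [C] *)

Section TraceForm.

Context {F : fieldType} {C : falgType F} {star : C -> C}.
Hypothesis charF : [pchar F] =i pred0.
Hypothesis starP : standard_involution star.
Implicit Types (x y z c : C) (k : F).

Local Notation nC := (comp_norm star).
Local Notation tC := (comp_trace star).

Lemma algI : injective (fun k => k%:A : C).
Proof. exact: can_inj in_algK. Qed.

Lemma two_neq0 : 2%:R != 0 :> F.
Proof. by have := charF 2%N; rewrite !inE /= => ->. Qed.

Lemma starE x : star x = (tC x)%:A - x.
Proof. by rewrite (comp_traceE starP) addrC addKr. Qed.

Lemma comp_traceD x y : tC (x + y) = tC x + tC y.
Proof.
apply: algI; rewrite scalerDl !(comp_traceE starP) (starD starP).
by rewrite addrACA.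
Qed.

Lemma comp_traceZ k x : tC (k *: x) = k * tC x.
Proof.
by apply: algI; rewrite -scalerA !(comp_traceE starP) (starZ starP) scalerDr.
Qed.

Lemma comp_trace1 : tC 1 = 2%:R.
Proof.
by apply: algI; rewrite (comp_traceE starP) (star1 starP) scaler_nat mulr2n.
Qed.

Lemma comp_trace_star x : tC (star x) = tC x.
Proof. by apply: algI; rewrite !(comp_traceE starP) (starK starP) addrC. Qed.

Lemma comp_normM x y : nC (x * y) = nC x * nC y.
Proof.
apply: algI; rewrite (comp_normE starP) (starM starP) mulrA -(mulrA x).
rewrite -(comp_normE starP) -scalerAr mulr1 -scalerAl -(comp_normE starP).
by rewrite scalerA mulrC.
Qed.

Lemma comp_norm_unit x : nC x != 0 -> x \is a GRing.unit.
Proof.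
move=> nx; apply/unitrP; exists ((nC x)^-1 *: star x).
rewrite -scalerAl -scalerAr -(comp_normE starP) -(comp_normEC starP).
by rewrite scalerA mulVf // scale1r.
Qed.

(* x^2 - tr(x) x + n(x) = 0, and tr(x x^* ) = 2 n(x). *)
Lemma comp_trace0_sqr x : tC x = 0 -> tC (x * star x) = 0 -> x * x = 0.
Proof.
move=> t0; rewrite -(comp_normE starP) comp_traceZ comp_trace1.
move/eqP; rewrite mulf_eq0 (negPf two_neq0) orbF => /eqP n0.
have := comp_normE starP x; rewrite n0 scale0r starE t0 scale0r sub0r mulrN.
by move/esym/eqP; rewrite oppr_eq0 => /eqP.
Qed.

(** Testing with [c = 1] and [c = star x] suffices: if both traces vanish, then [x * x = 0]. This
    covers [F] and the étale algebras; a split quaternion algebra has nilpotents and is treated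
    through a basis. *)
Lemma trace_nondegenerate_reduced :
  (forall x, x * x = 0 -> x = 0) ->
  forall x, x != 0 -> exists c, tC (x * c) != 0.
Proof.
move=> red x x0; case: (eqVneq (tC x) 0) => [t0|t0]; last first.
  by exists 1; rewrite mulr1.
case: (eqVneq (tC (x * star x)) 0) => [s0|s0]; last by exists (star x).
by rewrite (red x) ?eqxx // comp_trace0_sqr in x0.
Qed.

Lemma reduced_dim1 : \dim {:C} = 1%N -> forall x, x * x = 0 -> x = 0.
Proof.
move=> d1 x; have /vlineP[k ->] : x \in <[1 : C]>%VS.
  suff -> : <[1 : C]>%VS = fullv by rewrite memvf.
  by apply/eqP; rewrite eqEdim subvf d1 dim_vline oner_eq0.
rewrite -scalerAl mul1r scalerA -(scale0r 1) => /algI /eqP.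
by rewrite mulf_eq0 orbb => /eqP ->.
Qed.

(** Write [x] as the value at [x0] of a polynomial [g] of degree at most 1. Then [f] divides
    [g * g], and separability of [f] excludes degree 1, so [g] is a constant of square zero. *)
Lemma reduced_etale : @quadratic_etale_algebra F C ->
  forall x, x * x = 0 -> x = 0.
Proof.
case=> [x0 [f [_ sf sepf f0 bas]]] x xx.
have alg_horner2 (g : {poly F}) : (size g <= 2)%N ->
    horner_alg x0 g = g`_0 *: 1 + g`_1 *: x0.
  move=> sg; have gE : g = g`_1 *: 'X + (g`_0)%:P.
    apply/polyP=> -[|[|n]]; rewrite !coefE /= ?mulr0 ?mulr1 ?add0r ?addr0 //.
    by rewrite nth_default // (leq_trans sg).
  rewrite {1}gE -mul_polyC rmorphD rmorphM /= horner_algX !horner_algC.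
  by rewrite mulr_algl addrC.
have indep (g : {poly F}) : (size g <= 2)%N -> horner_alg x0 g = 0 -> g = 0.
  move=> sg; rewrite alg_horner2 // => g0.
  have /(_ (fun i => g`_i)) g_eq0 := @freeP _ _ _ [tuple 1; x0] (basis_free bas).
  have {}g_eq0 : forall i : 'I_2, g`_i = 0.
    by apply: g_eq0; rewrite !big_ord_recl big_ord0 addr0.
  apply/polyP=> -[|[|n]]; rewrite coef0; first exact: (g_eq0 0).
    exact: (g_eq0 1).
  by rewrite nth_default // (leq_trans sg).
have [g sg xE] : exists2 g : {poly F}, (size g <= 2)%N & horner_alg x0 g = x.
  have : x \in span [:: 1; x0] by rewrite (span_basis bas) memvf.
  rewrite span_cons span_seq1 => /memv_addP[_ /vlineP[p ->] [_ /vlineP[q ->] ->]].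
  exists (Poly [:: p; q]); first exact: size_Poly.
  by rewrite alg_horner2 ?size_Poly // !coef_Poly.
(* The remainder of [g * g] modulo [f] has size at most 2 and vanishes at [x0], so [indep] makes it
   zero. *)
have fgg : (f %| g * g)%R.
  have ff : f != 0 by rewrite -size_poly_eq0 sf.
  apply/eqP/indep; first by rewrite -ltnS -sf ltn_modp.
  have := congr1 (horner_alg x0) (divp_eq (g * g) f).
  by rewrite rmorphD !rmorphM /= f0 mulr0 add0r xE xx.
have [g0|g0] := eqVneq g 0; first by rewrite -xE g0 rmorph0.
have := sg; rewrite leq_eqVlt ltnS => /orP[/eqP s2|s1].
  (* Both polynomials have size 3, so divisibility makes them associates. A square dividing the
     separable [f] would make [g] coprime to itself, although [g] has degree 1. *)
  have ggf : (g * g %| f)%R.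
    suff /andP[] : (f %= g * g)%R by [].
    by rewrite -dvdp_size_eqp // sf size_mul // s2.
  by have := separable_coprime sepf ggf; rewrite coprimepp s2.
have gC := size1_polyC s1; move: xx g0; rewrite -xE gC horner_algC.
rewrite -scalerAl mul1r scalerA -(scale0r 1) => /algI /eqP.
by rewrite mulf_eq0 orbb => /eqP ->.
Qed.

(** Here [n(x) = x (tr(x) - x) = tr(x) x - k], so a nonzero trace would put [x] on the scalar
    line. *)
Lemma star_sqr_scalar x (k : F) :
  x \notin <[1 : C]>%VS -> x * x = k%:A -> star x = - x.
Proof.
move=> x1 xx; have := comp_normE starP x.
rewrite starE mulrBr xx -scalerAr mulr1.
case: (eqVneq (tC x) 0) => [-> _|t0 e]; first by rewrite scale0r sub0r.
case/negP: x1; apply/vlineP; exists ((tC x)^-1 * (nC x + k)).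
by rewrite -scalerA scalerDl e subrK scalerA mulVf // scale1r.
Qed.

(** In the basis [1, i, j, i * j] the form [tr(xy)] is diagonal with entries [2, 2a, 2b, -2ab], all
    nonzero. The basis element at the first nonzero coordinate of [x] serves as [c]. *)
Lemma trace_nondegenerate_quaternion : @quaternion_algebra F C ->
  forall x, x != 0 -> exists c, tC (x * c) != 0.
Proof.
case=> [a [b [i [j [[a0 b0] ii jj ij bas]]]]].
have indep (p q r s : F) : p *: 1 + q *: i + r *: j + s *: (i * j) = 0 ->
    [/\ p = 0, q = 0, r = 0 & s = 0].
  move=> e; have := @freeP _ _ _ [tuple 1; i; j; i * j] (basis_free bas).
  move=> /(_ (fun m => [:: p; q; r; s]`_m)) h.
  have {}h : forall m : 'I_4, [:: p; q; r; s]`_m = 0.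
    by apply: h; rewrite !big_ord_recl big_ord0 addr0 /= !addrA.
  by split; [exact: (h 0) | exact: (h 1) | exact: (h 2) | exact: (h 3)].
have ji : j * i = - (i * j) by rewrite ij opprK.
have pure x k : x \notin <[1 : C]>%VS -> x * x = k%:A -> tC x = 0.
  move=> x1 xx; apply: algI.
  by rewrite (comp_traceE starP) (star_sqr_scalar x1 xx) subrr scale0r.
have ti : tC i = 0.
  apply: (pure _ a) => //; apply/vlineP=> -[k ik].
  have /indep[_ /eqP] : - k *: 1 + 1 *: i + 0 *: j + 0 *: (i * j) = 0.
    by rewrite ik !scale0r scaleNr scale1r !addr0 addNr.
  by rewrite oner_eq0.
have tj : tC j = 0.
  apply: (pure _ b) => //; apply/vlineP=> -[k ik].
  have /indep[_ _ /eqP] : - k *: 1 + 0 *: i + 1 *: j + 0 *: (i * j) = 0.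
    by rewrite ik !scale0r scaleNr scale1r !addr0 addNr.
  by rewrite oner_eq0.
have iij : i * (i * j) = a *: j by rewrite mulrA ii -scalerAl mul1r.
have jij : j * (i * j) = - (b *: i).
  by rewrite mulrA ji mulNr -mulrA jj -scalerAr mulr1.
have iji : i * j * i = - (a *: j) by rewrite -mulrA ji mulrN iij.
have ijj : i * j * j = b *: i by rewrite -mulrA jj -scalerAr mulr1.
have ijij : i * j * (i * j) = (- (a * b))%:A.
  by rewrite -mulrA jij mulrN -scalerAr ii scalerA mulrC scaleNr.
have tij : tC (i * j) = 0.
  apply: (pure _ (- (a * b))) => //; apply/vlineP=> -[k ik].
  have /indep[_ _ _ /eqP] : - k *: 1 + 0 *: i + 0 *: j + 1 *: (i * j) = 0.
    by rewrite ik !scale0r scaleNr scale1r !addr0 addNr.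
  by rewrite oner_eq0.
have tN x : tC (- x) = - tC x by rewrite -scaleN1r comp_traceZ mulN1r.
move=> x; have : x \in span [:: 1; i; j; i * j] by rewrite (span_basis bas) memvf.
rewrite !span_cons span_nil addv0 => /memv_addP[_ /vlineP[p ->] [y]].
move=> /memv_addP[_ /vlineP[q ->] [z]].
move=> /memv_addP[_ /vlineP[r ->] [_ /vlineP[s ->] ->]] -> -> x0.
have tE c : tC ((p *: 1 + (q *: i + (r *: j + s *: (i * j)))) * c) =
    p * tC c + q * tC (i * c) + r * tC (j * c) + s * tC (i * j * c).
  by rewrite !mulrDl -!scalerAl mul1r !comp_traceD !comp_traceZ !addrA.
have [p0|p0] := eqVneq p 0; last first.
  exists 1; rewrite tE !mulr1 ti tj tij comp_trace1 !mulr0 !addr0.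
  by rewrite mulf_neq0 // two_neq0.
have [q0|q0] := eqVneq q 0; last first.
  exists i; rewrite tE ii ji iji !(tN, comp_traceZ) ti tj tij comp_trace1.
  by rewrite !(oppr0, mulr0, addr0, add0r) !mulf_neq0 // two_neq0.
have [r0|r0] := eqVneq r 0; last first.
  exists j; rewrite tE jj ijj !(tN, comp_traceZ) ti tj tij comp_trace1.
  by rewrite !(oppr0, mulr0, addr0, add0r) !mulf_neq0 // two_neq0.
have [s0|s0] := eqVneq s 0; last first.
  exists (i * j); rewrite tE ijij iij jij !(tN, comp_traceZ) ti tj tij comp_trace1.
  by rewrite !(oppr0, mulr0, addr0, add0r) !mulf_neq0 ?two_neq0 // oppr_eq0 mulf_neq0.
by rewrite p0 q0 r0 s0 !scale0r !addr0 eqxx in x0.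
Qed.

Lemma trace_nondegenerate : assoc_composition_algebra star ->
  forall x, x != 0 -> exists c, tC (x * c) != 0.
Proof.
case=> -[d1|et|qt] _.
- exact: trace_nondegenerate_reduced (reduced_dim1 d1).
- exact: trace_nondegenerate_reduced (reduced_etale et).
- exact: trace_nondegenerate_quaternion qt.
Qed.

End TraceForm.

(** * The adjoint of a Hermitian matrix of norm zero *)

Section RankOne.

Context {F : fieldType} {C : falgType F} {star : C -> C}.
Hypothesis charF : [pchar F] =i pred0.
Hypothesis compC : assoc_composition_algebra star.
Implicit Types (X Y : 'M[C]_3) (v : 'rV[C]_3) (x y z c : C).

Local Notation nC := (comp_norm star).
Local Notation tC := (comp_trace star).

Let starP : standard_involution star. Proof. by case: compC. Qed.

(** This is the first diagonal entry of the identity [(X^#)^# = n(X) X], solved for the norm of the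
    off-diagonal coordinate of [X^#]. *)
Lemma adj_diag_norm (c1 c2 c3 : F) (a1 a2 a3 : C) :
  nC (star a3 * star a2 - c1 *: a1) =
  (c3 * c1 - nC a2) * (c1 * c2 - nC a3)
  - c1 * (c1 * c2 * c3 - (c1 * nC a1 + c2 * nC a2 + c3 * nC a3)
          + tC (a1 * a2 * a3)).
Proof.
have nB (x y : C) : nC (x - y) = nC x + nC y - tC (x * star y).
  apply: (@algI F C); rewrite scalerBl scalerDl (comp_traceE starP) !(comp_normE starP).
  rewrite (starM starP) (starK starP) (starB starP) mulrBl !mulrBr.
  by rewrite opprB addrACA -opprD.
have nZ k x : nC (k *: x) = k * k * nC x.
  by rewrite /comp_norm (starZ starP) -scalerAl -scalerAr scalerA /scalar_part linearZ.
have nS x : nC (star x) = nC x.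
  by apply: (@algI F C); rewrite (comp_normE starP) (starK starP) -(comp_normEC starP).
rewrite nB comp_normM // !nS nZ (starZ starP) -scalerAr comp_traceZ //.
have -> : star a3 * star a2 * star a1 = star (a1 * a2 * a3).
  by rewrite !(starM starP) mulrA.
by rewrite comp_trace_star //; ring.
Qed.

(** This is the coordinate [a1] of [(X^#)^# = n(X) X]. The order of the factors matters, since [C]
    may be noncommutative. *)
Lemma adj_offdiag_mul (c1 c2 c3 : F) (a1 a2 a3 : C) :
  star (star a2 * star a1 - c3 *: a3) * star (star a1 * star a3 - c2 *: a2) =
  (c2 * c3 - nC a1) *: (star a3 * star a2 - c1 *: a1)
  + (c1 * c2 * c3 - (c1 * nC a1 + c2 * nC a2 + c3 * nC a3)
     + tC (a1 * a2 * a3)) *: a1.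
Proof.
rewrite !(starB starP) !(starM starP) !(starZ starP) !(starK starP).
rewrite mulrBl !mulrBr -!scalerAl -!scalerAr !scalerA.
have -> : a1 * a2 * star a2 = nC a2 *: a1.
  by rewrite -mulrA -(comp_normE starP) mulr_algr.
have -> : star a3 * (a3 * a1) = nC a3 *: a1.
  by rewrite mulrA -(comp_normEC starP) mulr_algl.
(* With [y = a1 a2 a3], multiply [y = tr(y) - y^*] on the right by [a1]; the last term ends in
   [a1^* a1 = n(a1)]. *)
have -> : a1 * a2 * (a3 * a1) =
    tC (a1 * a2 * a3) *: a1 - nC a1 *: (star a3 * star a2).
  rewrite -[tC _ *: _]mulr_algl (comp_traceE starP) mulrDl !(starM starP).
  rewrite -!mulrA -(comp_normEC starP) -!scalerAr mulr1; exact/esym/addrK.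
rewrite scalerBr !scalerA opprB -!scaleNr -[RHS]addrA -scalerDl.
rewrite [X in X + _ + _]addrC -[X in X + _]addrA -scalerDl addrACA -!scalerDl.
congr (_ *: _ + _ *: _); ring.
Qed.

Lemma herm_adj_rank_one X i j k : is_hermitian star X -> herm_norm star X = 0 ->
  herm_adj star X i k * herm_adj star X k j =
  herm_adj star X k k * herm_adj star X i j.
Proof.
move=> hX; rewrite /herm_norm /herm_adj.
move: (c_ X 0) (c_ X 1) (c_ X 2) (a1_ X) (a2_ X) (a3_ X) => c1 c2 c3 a1 a2 a3 n0.
(* The norm is invariant under cyclic shifts of the indices, so each of the two identities yields
   three instances with vanishing norm term. With their conjugates they settle all 27 index
   triples. *)
have n0' : c2 * c3 * c1 - (c2 * nC a2 + c3 * nC a3 + c1 * nC a1)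
    + tC (a2 * a3 * a1) = 0.
  by rewrite -[RHS]n0 -(mulrA a1) (comp_traceC starP a1); ring.
have n0'' : c3 * c1 * c2 - (c3 * nC a3 + c1 * nC a1 + c2 * nC a2)
    + tC (a3 * a1 * a2) = 0.
  by rewrite -[RHS]n0' -(mulrA a2) (comp_traceC starP a2); ring.
have := adj_diag_norm c1 c2 c3 a1 a2 a3.
have := adj_diag_norm c2 c3 c1 a2 a3 a1.
have := adj_diag_norm c3 c1 c2 a3 a1 a2.
have := adj_offdiag_mul c1 c2 c3 a1 a2 a3.
have := adj_offdiag_mul c2 c3 c1 a2 a3 a1.
have := adj_offdiag_mul c3 c1 c2 a3 a1 a2.
rewrite n0 n0' n0'' !mulr0 !subr0 !scale0r !addr0.
move: (c2 * c3 - nC a1) (c3 * c1 - nC a2) (c1 * c2 - nC a3) => d1 d2 d3.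
move: (star a3 * star a2 - _) (star a1 * star a3 - _) (star a2 * star a1 - _).
move=> b1 b2 b3 e3 e2 e1 m3 m2 m1.
have s1 := congr1 star e1; have s2 := congr1 star e2; have s3 := congr1 star e3.
rewrite !(starM starP, starZ starP, starK starP) in s1 s2 s3.
have sn x : star x * x = (nC x)%:A by rewrite (comp_normEC starP).
have ns x : x * star x = (nC x)%:A by rewrite (comp_normE starP).
case: i j k => -[|[|[|//]]] i [[|[|[|//]]] j] [[|[|[|//]]] k];
  rewrite !mxE /= ?sn ?ns ?(e1, e2, e3, s1, s2, s3) ?(m1, m2, m3)
    ?mulr_algl ?mulr_algr ?scalerA //.
all: by rewrite mulrC.
Qed.

(** In both cases it is enough to find [v] and a nonzero [t] in [F] with [v_i^* v_j = t Y_ij]; then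
    [gamma] is the inverse of [t]. *)
Lemma rank_one_dyad Y : is_hermitian star Y -> Y != 0 ->
  (forall i j k, Y i k * Y k j = Y k k * Y i j) ->
  exists (gamma : F) (v : 'rV[C]_3),
    gamma != 0 /\ Y = gamma%:A *: (conjtr star v *m v).
Proof.
move=> hY Y0 r1; have starY i j : star (Y i j) = Y j i by rewrite -[in RHS]hY !mxE.
have dyad (t : F) v : t != 0 -> (forall i j, star (v 0 i) * v 0 j = t *: Y i j) ->
    exists (gamma : F) (v : 'rV[C]_3),
      gamma != 0 /\ Y = gamma%:A *: (conjtr star v *m v).
  move=> t0 vE; exists t^-1, v; split; first by rewrite invr_eq0.
  apply/matrixP=> i j; rewrite !mxE big_ord1 !mxE vE mulr_algl scalerA.
  by rewrite mulVf // scale1r.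
case: (pickP (fun k => Y k k != 0)) => [k Yk|diag0].
  have YkE : Y k k = (scalar_part (Y k k))%:A by rewrite (fixed_scalar charF starP).
  apply: (dyad (scalar_part (Y k k)) (row k Y)) => [|i j].
    by apply: contraNneq Yk => t0; rewrite YkE t0 scale0r.
  by rewrite !mxE starY r1 [in LHS]YkE mulr_algl.
have {}diag0 k : Y k k = 0 by apply/eqP/negbFE/diag0.
have Ykl : exists k l, Y k l != 0.
  case: (pickP (fun kl : 'I_3 * 'I_3 => Y kl.1 kl.2 != 0)) => [[k l] h|h].
    by exists k, l.
  case/eqP: Y0; apply/matrixP=> k l; rewrite mxE; apply/eqP/negbFE.
  exact: (h (k, l)).
have {Ykl}[k [l Ykl]] := Ykl.
have [c tc] := trace_nondegenerate charF starP compC Ykl.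
have tE : (tC (Y k l * c))%:A = Y k l * c + star c * Y l k.
  by rewrite (comp_traceE starP) (starM starP) starY.
(* Cyclicity of the trace gives a second expansion of the same scalar: [tE] matches the index [k],
   this one the index [l]. *)
have tE' : (tC (Y k l * c))%:A = c * Y k l + Y l k * star c.
  by rewrite (comp_traceC starP) (comp_traceE starP) (starM starP) starY.
have r0 i m j : Y i m * Y m j = 0 by rewrite r1 diag0 mul0r.
apply: (dyad (tC (Y k l * c)) (row k Y + star c *: row l Y)) => // i j.
rewrite !mxE (starD starP) (starM starP) (starK starP) !starY.
rewrite mulrDl !mulrDr r0 add0r -!(mulrA (Y i l)) (mulrA c (star c)).
have -> : Y i l * (c * star c * Y l j) = 0.
  by rewrite -(comp_normE starP) mulr_algl -scalerAr r0 scaler0.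
rewrite addr0.
have mE (x : C) (t : F) : t *: x = t%:A * x by rewrite mulr_algl.
have mE' (x : C) (t : F) : t *: x = x * t%:A by rewrite mulr_algr.
(* What remains of [v_i^* v_j] is [Y_ik c^* Y_lj + Y_il c Y_kj]. If [i] or [j] is [k] or [l], a zero
   diagonal entry kills one term, and the scalar expanded as in [tE] or [tE'] produces the other. *)
case: (eqVneq i k) => [->|ik].
  by rewrite diag0 mul0r add0r mE tE mulrDl -!mulrA r0 mulr0 addr0.
case: (eqVneq i l) => [->|il].
  by rewrite diag0 mul0r addr0 mE tE' mulrDl -!mulrA r0 mulr0 add0r.
case: (eqVneq j k) => [->|jk].
  by rewrite diag0 !mulr0 addr0 mE' tE mulrDr !mulrA r0 mul0r add0r.
case: (eqVneq j l) => [->|jl].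
  by rewrite diag0 !mulr0 add0r mE' tE' mulrDr !mulrA r0 mul0r addr0.
have kl : k != l by apply: contraNneq Ykl => ->; rewrite diag0.
(* Only one index differs from both [k] and [l]. There [Y_ii = 0], and the two terms are conjugate,
   so their sum is a trace, zero by cyclicity and [Y_li Y_ik = 0]. *)
have -> : j = i.
  apply: val_inj; move: kl ik il jk jl.
  by case: i j k l {tc tE tE' Ykl} => -[|[|[|//]]] ? [[|[|[|//]]] ?]
    [[|[|[|//]]] ?] [[|[|[|//]]] ?].
have -> : Y i l * (c * Y k i) = star (Y i k * (star c * Y l i)).
  by rewrite !(starM starP) (starK starP) !starY mulrA.
rewrite diag0 scaler0 -(comp_traceE starP) (comp_traceC starP) -mulrA r0 mulr0.
by rewrite -(scale0r 0) comp_traceZ ?mul0r ?scale0r.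
Qed.

(** * Cancellation and scalar classes for matrices [v^* v] *)

Lemma unit_combination v : conjtr star v *m v != 0 ->
  exists u : 'cV[C]_3, nC ((v *m u) 0 0) != 0.
Proof.
move=> vv; have [i [j vij]] : exists i j, star (v 0 i) * v 0 j != 0.
  case: (pickP (fun ij : 'I_3 * 'I_3 => star (v 0 ij.1) * v 0 ij.2 != 0)).
    by case=> i j h; exists i, j.
  move=> h; case/eqP: vv; apply/matrixP=> i j; rewrite !mxE big_ord1 !mxE.
  by apply/eqP/negbFE; exact: (h (i, j)).
have v_delta k : v *m delta_mx k 0 = col k v by rewrite colE.
case: (eqVneq (nC (v 0 i)) 0) => [ni|ni]; last first.
  by exists (delta_mx i 0); rewrite v_delta mxE.
case: (eqVneq (nC (v 0 j)) 0) => [nj|nj]; last first.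
  by exists (delta_mx j 0); rewrite v_delta mxE.
have [c tc] := trace_nondegenerate charF starP compC vij.
pose u : 'cV[C]_3 := delta_mx i 0 + delta_mx j 0 *m (c%:M : 'M_1); exists u.
have -> : (v *m u) 0 0 = v 0 i + v 0 j * c.
  by rewrite mulmxDr mulmxA !v_delta !mxE big_ord1 !mxE eqxx mulr1n.
(* Expanding the norm of [v_i + v_j c] when [n(v_i) = n(v_j) = 0] leaves only the trace of
   [v_i^* v_j c]. *)
apply: contraNneq tc => n0; apply/eqP/(@algI F C); rewrite scale0r.
have := comp_normEC starP (v 0 i + v 0 j * c).
rewrite n0 scale0r (starD starP) (starM starP) mulrDl !mulrDr.
rewrite -(comp_normEC starP (v 0 i)) ni scale0r add0r -!(mulrA (star c)).
rewrite (mulrA (star (v 0 j)) (v 0 j)).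
rewrite -(comp_normEC starP (v 0 j)) nj scale0r mul0r mulr0 addr0 => e.
by rewrite (comp_traceE starP) !(starM starP) (starK starP) -(mulrA _ _ c).
Qed.

Lemma mulmx_scaleA m n p (k : F) (A : 'M[C]_(m, n)) (B : 'M[C]_(n, p)) :
  A *m (k%:A *: B) = k%:A *: (A *m B).
Proof.
apply/matrixP=> i j; rewrite !mxE mulr_sumr; apply: eq_bigr => l _.
by rewrite !mxE !mulr_algl -scalerAr.
Qed.

Lemma conjtr_mul_self (z : 'M[C]_1) : (conjtr star z *m z) 0 0 = (nC (z 0 0))%:A.
Proof. by rewrite !mxE big_ord1 !mxE (comp_normEC starP). Qed.

Lemma dyad_annihilator v (w : 'rV[C]_3) :
  conjtr star v *m v != 0 -> conjtr star v *m w = 0 -> w = 0.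
Proof.
case/unit_combination=> u nu vw.
have : conjtr star (v *m u) *m w = 0 by rewrite (conjtrM starP) -mulmxA vw mulmx0.
move/matrixP=> h; apply/matrixP=> i j; rewrite (ord1 i) [RHS]mxE.
have := h 0 j; rewrite [RHS]mxE mxE big_ord1 [in LHS]mxE [in LHS]mxE.
move/(congr1 ( *%R ((v *m u) 0 0))); rewrite mulr0 mulrA -(comp_normE starP).
by rewrite mulr_algl => /eqP; rewrite scaler_eq0 (negPf nu) => /eqP.
Qed.

(** Sandwiching both sides between [u^*] and [u], with [n(vu)] nonzero, gives [k n(vu) = k' n(v'u)].
    Hence [n(v'u)] is nonzero too, and [z] is the quotient of [vu] by [v'u]. *)
Lemma dyad_scalar_class (k k' : F) v v' : k != 0 ->
  k%:A *: (conjtr star v *m v) != 0 ->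
  k%:A *: (conjtr star v *m v) = k'%:A *: (conjtr star v' *m v') ->
  exists2 z : C, z \is a GRing.unit & k' = k * nC z.
Proof.
move=> k0 Y0 e; have vv : conjtr star v *m v != 0.
  by apply: contraNneq Y0 => ->; rewrite scaler0.
have [u nu] := unit_combination vv.
have uE (t : F) (w : 'rV[C]_3) :
    (conjtr star u *m (t%:A *: (conjtr star w *m w)) *m u) 0 0 =
    (t * nC ((w *m u) 0 0))%:A.
  rewrite mulmx_scaleA -scalemxAl mxE mulr_algl -scalerA -conjtr_mul_self.
  by rewrite (conjtrM starP) !mulmxA.
have := uE k' v'; rewrite -e uE => /algI h.
have n' : nC ((v' *m u) 0 0) != 0.
  have : k' * nC ((v' *m u) 0 0) != 0 by rewrite -h mulf_neq0.
  by rewrite mulf_eq0 negb_or => /andP[].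
exists ((v *m u) 0 0 * ((v' *m u) 0 0)^-1).
  by rewrite unitrMl ?unitrV (comp_norm_unit starP).
have n1 : nC 1 = 1.
  by apply: (@algI F C); rewrite (comp_normE starP) mul1r (star1 starP) scale1r.
have nV : nC ((v' *m u) 0 0) * nC ((v' *m u) 0 0)^-1 = 1.
  by rewrite -comp_normM // divrr ?(comp_norm_unit starP) ?n1.
by rewrite comp_normM // mulrA h -mulrA nV mulr1.
Qed.

End RankOne.

(** * Rank-one elements of [U(gamma)] *)

Theorem theorem8p2 (F : fieldType) (charF : [pchar F] =i pred0)
    (C : falgType F) (star : C -> C)
    (hC : assoc_composition_algebra star)
    (X : 'M[C]_3) (hX : is_hermitian star X) :
  [/\ (exists (gamma : F) (v : 'rV[C]_3),
          gamma != 0 /\ U_rank_one star gamma (X, v)) ->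
        herm_norm star X = 0 /\ rank_at_most_two star X,
      rank_exactly_two star X ->
        forall (gamma : F) (v : 'rV[C]_3), gamma != 0 ->
          (U_rank_one star gamma (X, v) <->
           herm_adj star X = - (gamma%:A *: (conjtr star v *m v)))
    & rank_exactly_two star X ->
        (exists (gamma : F) (v : 'rV[C]_3),
            gamma != 0 /\
            herm_adj star X = - (gamma%:A *: (conjtr star v *m v)))
        /\ (forall (gamma gamma' : F) (v v' : 'rV[C]_3),
              gamma != 0 -> gamma' != 0 ->
              herm_adj star X = - (gamma%:A *: (conjtr star v *m v)) ->
              herm_adj star X = - (gamma'%:A *: (conjtr star v' *m v')) ->
              exists2 z : C, z \is a GRing.unit &
                gamma' = gamma * comp_norm star z)].
Proof.
have starP : standard_involution star by case: hC.
have adjX := herm_adj_mul charF starP hX.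
have scaleA_inj (k : F) m n (A : 'M[C]_(m, n)) : k != 0 -> k%:A *: A = 0 -> A = 0.
  move=> k0 /(congr1 (fun B => k^-1%:A *: B)); rewrite scaler0 scalerA.
  by rewrite mulr_algl scalerA mulVf // !scale1r.
split.
- case=> gamma [v [_ [_ _ U0]]].
  have /= /eqP := congr1 fst U0; rewrite addr_eq0 => /eqP adjE.
  have /= /eqP := congr1 snd U0; rewrite oppr_eq0 => /eqP vX.
  suff n0 : herm_norm star X = 0 by split.
  (* Since [vX = 0], the product [X^# X = -gamma v^* v X] vanishes, while it is also the scalar
     matrix [n(X)]. *)
  move: adjX; rewrite adjE mulNmx -scalemxAl -mulmxA vX mulmx0 scaler0 oppr0.
  move=> /matrixP/(_ 0 0); rewrite !mxE eqxx mulr1n -(scale0r 1).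
  by move/algI.
- case=> n0 adj0 gamma v g0; split=> [[_ _ U0]|adjE].
    by have /= /eqP := congr1 fst U0; rewrite addr_eq0 => /eqP.
  split=> //.
    case=> _ v0; apply: adj0.
    by rewrite adjE v0 mulmx0 scaler0 oppr0.
  rewrite /U_adj /= adjE addNr; congr (_, _).
  suff -> : v *m X = 0 by rewrite oppr0.
  (* Take [w = vX]: up to the factor [-gamma], the product [v^* w] is [X^# X = n(X) = 0]. *)
  apply: (dyad_annihilator charF hC (v := v)).
    by apply/eqP=> vv; apply: adj0; rewrite adjE vv scaler0 oppr0.
  apply: (scaleA_inj gamma) => //.
  rewrite mulmxA scalemxAl -[X in X *m _]opprK -adjE mulNmx adjX n0 scale0r.
  by rewrite raddf0 oppr0.
case=> n0 /eqP adj0; split.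
  have [gamma [v [g0 e]]] := rank_one_dyad charF hC (herm_adj_hermitian starP X)
    adj0 (fun i j k => herm_adj_rank_one hC i j k hX n0).
  (* The sign turns [X^# = gamma v^* v] into the convention of [U(gamma)]. *)
  exists (- gamma), v; rewrite oppr_eq0; split=> //.
  by rewrite scaleNr scaleNr opprK.
move=> gamma gamma' v v' g0 _ e e'.
apply: (dyad_scalar_class charF hC (v := v) (v' := v')) => //.
  by rewrite -oppr_eq0 -e.
by apply: oppr_inj; rewrite -e -e'.
Qed.
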